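(* Let $X_1,\dots,X_n$ be bounded variables and let $B_1,\dots,B_n$ be real numbers with $\sup X_i-\inf X_i\le B_i$ for each $i$. Put $\gamma_n=\sum_{i=1}^n B_i^2$ and suppose $\gamma_n>0$. Suppose that $X_1,\dots,X_n$ satisfy weak irrelevance and that disintegrability holds (both as defined in the context). Then for every $\epsilon>0$, $$\overline{P}\Big(\sum_{i=1}^n (X_i-\overline{E}[X_i])\ge\epsilon\Big)\le e^{-2\epsilon^2/\gamma_n} \quad\text{and}\quad \overline{P}\Big(\sum_{i=1}^n (X_i-\underline{E}[X_i])\le-\epsilon\Big)\le e^{-2\epsilon^2/\gamma_n}.$$
   Context: Variables are real-valued functions on a possibility space $\Omega$; an event is identified with its indicator function. An expectation functional $E$ maps bounded variables to real numbers and satisfies: (1) if $\alpha\le X\le\beta$ pointwise, with $\alpha,\beta$ real numbers, then $\alpha\le E[X]\le\beta$; (2) $E[X+Y]=E[X]+E[Y]$. It induces a finitely additive probability measure by $P(A)=E[A]$. A nonempty set $\mathcal{K}$ of expectation functionals is fixed. Lower and upper expectations are $\underline{E}[X]=\inf_{E\in\mathcal{K}}E[X]$ and $\overline{E}[X]=\sup_{E\in\mathcal{K}}E[X]$; $\underline{P}(A)=\underline{E}[A]$ and $\overline{P}(A)=\overline{E}[A]$. In the countably additive setting ''variable'' and ''event'' mean measurable ones with respect to a fixed $\sigma$-algebra. Notation: $X_{1:k}$ stands for $X_1,\dots,X_k$, and $A(X_{1:k})$ denotes an event defined by $X_{1:k}$, i.e. of the form $\{(X_1,\dots,X_k)\in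 S\}$. Conditioning is elementwise: given an event $A$, each $E\in\mathcal{K}$ (with measure $P$) has a conditional expectation functional $E[\cdot|A]$ with $E[X|A]P(A)=E[XA]$, and $\underline{E}[X|A]$, $\overline{E}[X|A]$ are the infimum and supremum of the resulting $E[X|A]$. There are two set-ups. (I) Full conditional measures: for each member of $\mathcal{K}$, $E[\cdot|A]$ is defined for every nonempty $A$, it is the expectation functional of $P(\cdot|A)$, and $P(\cdot|\cdot)$ satisfies, for nonempty conditioning events, $P(C|C)=1$; $P(A|C)\ge0$; $P(A\cup B|C)=P(A|C)+P(B|C)$ for disjoint $A,B$; $P(A\cap B|C)=P(A|B\cap C)P(B|C)$ if $B\cap C\ne\emptyset$; with $P(\cdot|\Omega)=P$. (II) $E[\cdot|A]$ is defined only when $P(A)>0$; then $\underline{E}[X|A]$ and $\overline{E}[X|A]$ are the infimum and supremum over those members of $\mathcal{K}$ with $P(A)>0$, and are defined when $\overline{P}(A)>0$. Weak irrelevance of $X_1,\dots,X_n$ means that at least one of the following holds: (W1) in set-up (I), for any $i\in\{2,\dots,n\}$ and any nonempty event $A(X_{1:i-1})$, $\underline{E}[X_i|A(X_{1:i-1})]=\underline{E}[X_i]$ and $\overline{E}[X_i|A(X_{1:i-1})]=\overline{E}[X_i]$; (W2) in set-up (II), for any $i\in\{2,\dots,n\}$ and any event $A(X_{1:i-1})$ with $\overline{P}(A(X_{1:i-1}))>0$, the same two equalities hold. Disintegrability means $\overline{E}[W]\le\overline{E}\big[\overline{E}[W|Z]\big]$ for the nonnegative bounded $W$ and the $Z$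 of interest, namely $W$ a function of $X_{1:k+1}$ and $Z=X_{1:k}$, $1\le k<n$. Here $\overline{E}[W|Z]$ is the variable taking the value $\overline{E}[W|Z=z]$ where $Z=z$ (and $0$ where this is undefined). The paper regards disintegrability as also holding when every $P$ is countably additive, with conditional expectations given variables taken in the usual Kolmogorov sense, in the elementwise form $E_P[W]=E_P[E_P[W|Z]]$ for every $P$; this form is also admitted. *)

(* Defs.v *)
From HB Require Import structures.
From mathcomp Require Export all_boot all_order all_algebra.
From mathcomp Require Export all_classical all_reals all_analysis.
Export Order.TTheory GRing.Theory Num.Theory.
Export numFieldNormedType.Exports.

Set Implicit Arguments.
Unset Strict Implicit.
Unset Printing Implicit Defensive.

Local Open Scope classical_set_scope.
Local Open Scope ring_scope.

Section Expectations.
Context {R : realType} {d : measure_display} {Omega : measurableType d}.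

(* The measurable sets of Omega are the events.  The purely finitely additive
   theory, where every function is a variable and every set an event, is the
   case of the discrete sigma-algebra. *)
Definition bounded_variable (X : Omega -> R) : Prop :=
  measurable_fun setT X /\ bounded_fun X.

(* Functionals are total on Omega -> R, but only their values on bounded
   variables are meaningful. *)
Definition expectation_functional (E : (Omega -> R) -> R) : Prop :=
  (forall (X : Omega -> R) (a b : R), bounded_variable X ->
     (forall w, a <= X w <= b) -> a <= E X <= b) /\
  (forall X Y : Omega -> R, bounded_variable X -> bounded_variable Y ->
     E (X \+ Y) = E X + E Y).

Definition lower (K : set ((Omega -> R) -> R)) (X : Omega -> R) : R :=
  inf [set E X | E in K].

Definition upper (K : set ((Omega -> R) -> R)) (X : Omega -> R) : R :=
  sup [set E X | E in K].

Inductive setup := FullConditional | PositiveProbability.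

(* [defined_for s E A]: the member E has a conditional expectation given A. *)
Definition defined_for (s : setup) (E : (Omega -> R) -> R) (A : set Omega) :
    Prop :=
  match s with
  | FullConditional => A !=set0
  | PositiveProbability => 0 < E \1_A
  end.

(* [defined_given s K A]: lower and upper expectations given A are defined. *)
Definition defined_given (s : setup) (K : set ((Omega -> R) -> R))
    (A : set Omega) : Prop :=
  match s with
  | FullConditional => A !=set0
  | PositiveProbability => 0 < upper K \1_A
  end.

(* Pc A C stands for P(A | C). *)
Definition full_conditional_measure (P : set Omega -> R)
    (Pc : set Omega -> set Omega -> R) : Prop :=
  [/\ forall C, measurable C -> C !=set0 -> Pc C C = 1,
      forall A C, measurable A -> measurable C -> C !=set0 -> 0 <= Pc A C,
      forall A B C, measurable A -> measurable B -> measurable C ->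
        C !=set0 -> A `&` B = set0 -> Pc (A `|` B) C = Pc A C + Pc B C,
      forall A B C, measurable A -> measurable B -> measurable C ->
        B `&` C !=set0 -> Pc (A `&` B) C = Pc A (B `&` C) * Pc B C &
      forall A, measurable A -> Pc A setT = P A].

(* cond E A X stands for E[X | A]. *)
Definition conditioning (s : setup) (K : set ((Omega -> R) -> R))
    (cond : ((Omega -> R) -> R) -> set Omega -> (Omega -> R) -> R) : Prop :=
  forall E, K E ->
    (forall A, measurable A -> defined_for s E A ->
       expectation_functional (cond E A) /\
       forall X, bounded_variable X -> cond E A X * E \1_A = E (X \* \1_A)) /\
    match s with
    | FullConditional =>
        full_conditional_measure (fun A => E \1_A) (fun A C => cond E C \1_A)
    | PositiveProbability => True
    end.

Definition lower_given (s : setup) (K : set ((Omega -> R) -> R))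
    (cond : ((Omega -> R) -> R) -> set Omega -> (Omega -> R) -> R)
    (A : set Omega) (X : Omega -> R) : R :=
  inf [set cond E A X | E in [set E | K E /\ defined_for s E A]].

Definition upper_given (s : setup) (K : set ((Omega -> R) -> R))
    (cond : ((Omega -> R) -> R) -> set Omega -> (Omega -> R) -> R)
    (A : set Omega) (X : Omega -> R) : R :=
  sup [set cond E A X | E in [set E | K E /\ defined_for s E A]].

(* The upper expectation of W given the vector Z, as a function on Omega. *)
Definition upper_given_vector (s : setup) (K : set ((Omega -> R) -> R))
    (cond : ((Omega -> R) -> R) -> set Omega -> (Omega -> R) -> R)
    (k : nat) (W : Omega -> R) (Z : Omega -> k.-tuple R) (w : Omega) : R :=
  let A := Z @^-1` [set Z w] in
  if `[< defined_given s K A >] then upper_given s K cond A W else 0.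

Definition prefix n (X : 'I_n -> Omega -> R) k (h : (k <= n)%N) :
    'I_k -> Omega -> R :=
  fun j => X (widen_ord h j).

Definition joint k (Y : 'I_k -> Omega -> R) (w : Omega) : k.-tuple R :=
  [tuple Y j w | j < k].

(* With indices starting at 0, the predecessors of X i are the entries of
   prefix X (ltnW (ltn_ord i)), and prefix X (ltn_ord i) adds X i itself. *)
Definition weak_irrelevance (s : setup) (K : set ((Omega -> R) -> R))
    (cond : ((Omega -> R) -> R) -> set Omega -> (Omega -> R) -> R)
    n (X : 'I_n -> Omega -> R) : Prop :=
  forall (i : 'I_n) (S : set (i.-tuple R)), (0 < i)%N ->
    let A := joint (prefix X (ltnW (ltn_ord i))) @^-1` S in
    measurable A -> defined_given s K A ->
    lower_given s K cond A (X i) = lower K (X i) /\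
    upper_given s K cond A (X i) = upper K (X i).

Definition function_of k (W : Omega -> R) (Y : 'I_k -> Omega -> R) : Prop :=
  exists g : k.-tuple R -> R, W = g \o joint Y.

(* The upper expectation of W given Z has to be a variable for the outer upper
   expectation to make sense; this is automatic for the discrete
   sigma-algebra. *)
Definition upper_disintegrability (s : setup) (K : set ((Omega -> R) -> R))
    (cond : ((Omega -> R) -> R) -> set Omega -> (Omega -> R) -> R)
    n (X : 'I_n -> Omega -> R) : Prop :=
  forall (k : 'I_n) (W : Omega -> R), (0 < k)%N ->
    bounded_variable W -> (forall w, 0 <= W w) ->
    function_of W (prefix X (ltn_ord k)) ->
    let V := upper_given_vector s K cond W
               (joint (prefix X (ltnW (ltn_ord k)))) in
    measurable_fun setT V /\ upper K W <= upper K V.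

(* V is a version of the Kolmogorov conditional expectation of W given Y. *)
Definition conditional_expectation (mu : probability Omega R)
    k (Y : 'I_k -> Omega -> R) (W V : Omega -> R) : Prop :=
  [/\ mu.-integrable setT (EFin \o V),
      forall B : set R, measurable B -> g_sigma_preimage Y (V @^-1` B) &
      forall A : set Omega, g_sigma_preimage Y A ->
        (\int[mu]_(w in A) (V w)%:E = \int[mu]_(w in A) (W w)%:E)%E].

(* Every member of K has a countably additive measure mu.  The identity for
   Kolmogorov conditional expectations is then a consequence; it is required of
   every version, so that no existence result is assumed. *)
Definition kolmogorov_disintegrability (K : set ((Omega -> R) -> R))
    n (X : 'I_n -> Omega -> R) : Prop :=
  forall E, K E -> exists mu : probability Omega R,
    (forall A, measurable A -> mu A = (E \1_A)%:E) /\
    forall (k : 'I_n) (W V : Omega -> R), (0 < k)%N ->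
      bounded_variable W -> (forall w, 0 <= W w) ->
      function_of W (prefix X (ltn_ord k)) ->
      conditional_expectation mu (prefix X (ltnW (ltn_ord k))) W V ->
      (E W)%:E = ('E_mu[V])%E.

Definition disintegrability (s : setup) (K : set ((Omega -> R) -> R))
    (cond : ((Omega -> R) -> R) -> set Omega -> (Omega -> R) -> R)
    n (X : 'I_n -> Omega -> R) : Prop :=
  upper_disintegrability s K cond X \/ kolmogorov_disintegrability K X.

End Expectations.

(* Main.v *)
Require Import Defs.
From mathcomp Require Import ring lra measurable_realfun.

Set Implicit Arguments.
Unset Strict Implicit.
Unset Printing Implicit Defensive.

Local Open Scope classical_set_scope.
Local Open Scope ring_scope.

(** Each member E of K is treated separately: under E the centred variables
    behave like supermartingale differences, and the Azuma-Hoeffding argument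
    applies to them with finite additivity only.

    If A is an event of the past X_1, ..., X_(i-1) and P(A) > 0, then
    E[X_i 1_A] = E[X_i | A] P(A), and weak irrelevance bounds E[X_i | A] by the
    unconditional lower and upper expectations of X_i.  So Y_i = X_i - upper
    (or lower - X_i, for the second inequality) satisfies E[Y_i 1_A] <= 0 for
    every past event A, whether P(A) is positive or not: this is
    [irrelevance_bounds].  A nonnegative bounded function W of the past is a
    uniform limit of positive combinations of the indicators of its superlevel
    events, which are past events; hence E[W Y_i] <= 0, which is
    [expectation_weighted_le0].  The approximation has to be uniform, since a
    finitely additive expectation need not commute with pointwise limits.

    For s >= 0, Hoeffding's lemma is used in the pointwise form
    exp(s y) <= exp(s^2 (b - a)^2 / 8) + beta y on [a, b], with beta >= 0
    ([exp_le_affine]).  Multiplying it by W = exp(s (Y_1 + ... + Y_(i-1))) and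
    taking expectations, the term in beta disappears, so each step multiplies
    the exponential moment by at most exp(s^2 B_i^2 / 8).  Markov's inequality
    at s = 4 eps / gamma gives [azuma_hoeffding], and the supremum over E in K
    preserves the bound. *)

(** * Hoeffding's lemma *)

Lemma ge0_of_is_derive (R : realType) (f df : R -> R) :
    f 0 = 0 -> (forall x : R, is_derive x 1 f (df x)) ->
    (forall x, 0 <= x -> 0 <= df x) ->
  forall x, 0 <= x -> 0 <= f x.
Proof.
move=> f0 fdf df_ge0 x; rewrite le_eqVlt => /predU1P[<-|x_gt0].
  by rewrite f0.
have [|c] := @MVT R f df 0 x x_gt0 (fun y _ => fdf y).
  apply: continuous_subspaceT => y.
  by apply: differentiable_continuous; apply/derivable1_diffP; case: (fdf y).
rewrite in_itv /= => /andP[c_gt0 _]; rewrite f0 !subr0 => ->.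
by rewrite mulr_ge0 ?df_ge0 // ltW.
Qed.

(** The exponential moment of a centred Bernoulli variable.  The logarithm of
    the left-hand side has second derivative q (1 - q) <= 1 / 4, where q is the
    success probability after exponential tilting; two integrations from 0 give
    h^2 / 8. *)
Lemma bernoulli_mgf_le (R : realType) (p h : R) : 0 <= p <= 1 -> 0 <= h ->
  (1 - p) * expR (- (p * h)) + p * expR ((1 - p) * h) <= expR (h ^+ 2 / 8).
Proof.
move=> /andP[p_ge0 p_le1] h_ge0.
pose N (x : R) : R := 1 - p + p * expR x.
have N_gt0 x : 0 < N x.
  rewrite /N; have := expR_gt0 x; set e := expR x => e_gt0.
  have [p_half|p_half] := lerP p (1 / 2).
    by apply: ltr_wpDr; [exact: mulr_ge0 (ltW _)|lra].
  by apply: ltr_wpDl; [lra|apply: mulr_gt0 => //; lra].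
have NP (x : R) : is_derive x 1 N (p * expR x).
  rewrite /N; apply: is_derive_eq.
  by rewrite /GRing.scale /= add0r mul1r.
pose q (x : R) := p * expR x / N x.
(* The derivative of h^2 / 8 + p h - ln (N h) is h / 4 + p - q h. *)
have g_ge0 x : 0 <= x -> 0 <= x / 4 + p - q x.
  move: x; apply: (@ge0_of_is_derive _ (fun x => x / 4 + p - q x)
    (fun x => 1 / 4 - q x * (1 - q x))).
  - by rewrite /q /N expR0 mulr1 subrK divr1 mul0r add0r subrr.
  - move=> x; rewrite /q.
    have N0 : N x != 0 by rewrite gt_eqF.
    have VP := is_deriveV N0 (NP x).
    apply: is_derive_eq.
    rewrite /GRing.scale /=; rewrite /N in N0 *; by field.
  - by move=> x _; have := sqr_ge0 (q x - 1 / 2); nra.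
have L_ge0 : 0 <= h ^+ 2 / 8 + p * h - ln (N h).
  move: (h) h_ge0.
  apply: (@ge0_of_is_derive _ (fun x => x ^+ 2 / 8 + p * x - ln (N x))
    (fun x => x / 4 + p - q x)).
  - by rewrite /N expR0 mulr1 subrK ln1 expr0n /= !mul0r mulr0 addr0 subr0.
  - move=> x; have := @is_derive1_ln _ _ (N_gt0 x) => lnP.
    have lnNP := @is_derive1_comp _ (@ln R) N x _ _ lnP (NP x).
    apply: is_derive_eq; rewrite /GRing.scale /= /q.
    have N0 : N x != 0 by rewrite gt_eqF.
    by field.
  - exact: g_ge0.
have -> : (1 - p) * expR (- (p * h)) + p * expR ((1 - p) * h) =
    expR (- (p * h)) * N h.
  have -> : (1 - p) * h = - (p * h) + h by ring.
  by rewrite expRD /N; ring.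
rewrite -{1}[N h]lnK ?posrE // -expRD ler_expR; lra.
Qed.

(** The chord of exp(s y) over [a, b] lies above the curve by convexity, and its
    value at 0 is a centred Bernoulli moment with p = - a / (b - a) and
    h = s (b - a).  Unlike the usual bound on a moment, this pointwise form can
    be multiplied by a weight before any expectation is taken, and the sign of
    the slope makes E[Y] <= 0, rather than E[Y] = 0, sufficient. *)
Lemma exp_le_affine (R : realType) (a b s : R) : a <= 0 -> 0 <= b -> 0 <= s ->
  exists2 beta, 0 <= beta & forall y, a <= y <= b ->
    expR (s * y) <= expR (s ^+ 2 * (b - a) ^+ 2 / 8) + beta * y.
Proof.
move=> a_le0 b_ge0 s_ge0.
have [ab|ba] := ltP a b; last first.
  exists 0 => // y /andP[ay yb]; have y0 : y = 0 by apply: le_anti; lra.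
  rewrite y0 !mulr0 addr0 ler_expR; apply: mulr_ge0; last by lra.
  by apply: mulr_ge0; rewrite sqr_ge0.
have ba_gt0 : 0 < b - a by lra.
exists ((expR (s * b) - expR (s * a)) / (b - a)).
  by rewrite divr_ge0 ?subr_ge0 ?ler_expR ?ler_wpM2l // ltW.
move=> y /andP[ay yb].
have ba0 : b - a != 0 by rewrite gt_eqF.
set al := b / (b - a) * expR (s * a) + - a / (b - a) * expR (s * b).
have al_le : al <= expR (s ^+ 2 * (b - a) ^+ 2 / 8).
  have p01 : 0 <= - a / (b - a) <= 1.
    by rewrite divr_ge0 ?ler_pdivrMr //=; lra.
  have h_ge0 : 0 <= s * (b - a) by rewrite mulr_ge0 // ltW.
  have := bernoulli_mgf_le p01 h_ge0; rewrite exprMn.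
  have -> : - (- a / (b - a) * (s * (b - a))) = s * a by field.
  have -> : (1 - - a / (b - a)) * (s * (b - a)) = s * b by field.
  by have -> : 1 - - a / (b - a) = b / (b - a) by field.
apply: (@le_trans _ _ (al + (expR (s * b) - expR (s * a)) / (b - a) * y));
  last by rewrite lerD2r.
have -> : al + (expR (s * b) - expR (s * a)) / (b - a) * y =
   ((b - y) * expR (s * a) + (y - a) * expR (s * b)) / (b - a).
  by rewrite /al; field.
rewrite ler_pdivlMr //.
(* Evaluated at a and b, the tangent of z |-> exp(s z) at y bounds the chord. *)
have tangent z : expR (s * y) * (1 + s * (z - y)) <= expR (s * z).
  have -> : s * z = s * y + s * (z - y) by ring.
  by rewrite expRD ler_pM2l ?expR_gt0 //; exact: expR_ge1Dx.
have yb' : 0 <= b - y by lra.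
have ya' : 0 <= y - a by lra.
have := ler_wpM2l yb' (tangent a); have := ler_wpM2l ya' (tangent b).
lra.
Qed.

(** * Bounded variables *)

Section BoundedVariables.
Context {R : realType} {d : measure_display} {Omega : measurableType d}.
Implicit Types (X Y : Omega -> R) (A : set Omega).

Lemma bounded_variableP X : bounded_variable X <->
  measurable_fun setT X /\ exists M, forall w, `|X w| <= M.
Proof.
split=> [[mX [M [_ XM]]]|[mX [M XM]]].
  by split=> //; exists (M + 1) => w; apply: XM => //; rewrite ltrDl.
split=> //; exists M; split=> [|N MN w _]; first exact: num_real.
exact: le_trans (XM w) (ltW MN).
Qed.

Lemma bounded_variable_cst (c : R) :
  bounded_variable (fun _ : Omega => c).
Proof. by apply/bounded_variableP; split; last exists `|c|. Qed.

Lemma bounded_variableD X Y : bounded_variable X -> bounded_variable Y ->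
  bounded_variable (fun w => X w + Y w).
Proof.
move=> /bounded_variableP[mX [M XM]] /bounded_variableP[mY [N YN]].
apply/bounded_variableP; split; first exact: measurable_funD.
by exists (M + N) => w; rewrite (le_trans (ler_normD _ _)) ?lerD.
Qed.

Lemma bounded_variableM X Y : bounded_variable X -> bounded_variable Y ->
  bounded_variable (fun w => X w * Y w).
Proof.
move=> /bounded_variableP[mX [M XM]] /bounded_variableP[mY [N YN]].
apply/bounded_variableP; split; first exact: measurable_funM.
by exists (M * N) => w; rewrite normrM ler_pM.
Qed.

Lemma bounded_variableB X Y : bounded_variable X -> bounded_variable Y ->
  bounded_variable (fun w => X w - Y w).
Proof.
move=> bX bY; have := bounded_variableM (bounded_variable_cst (-1)) bY.
move=> /(bounded_variableD bX); congr bounded_variable.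
by apply/funext => w; rewrite mulN1r.
Qed.

Lemma bounded_variable_sum (I : Type) (r : seq I) (P : pred I)
    (F : I -> Omega -> R) : (forall i, bounded_variable (F i)) ->
  bounded_variable (fun w => \sum_(i <- r | P i) F i w).
Proof.
move=> bF; elim: r => [|i r IHr].
  by under eq_fun do rewrite big_nil; exact: bounded_variable_cst.
under eq_fun do rewrite big_cons; case: (P i) => //.
exact: bounded_variableD.
Qed.

Lemma bounded_variable_expR X :
  bounded_variable X -> bounded_variable (fun w => expR (X w)).
Proof.
move=> /bounded_variableP[mX [M XM]]; apply/bounded_variableP; split.
  exact: measurableT_comp.
exists (expR M) => w; rewrite ger0_norm ?expR_ge0 // ler_expR.
exact: le_trans (ler_norm _) (XM w).
Qed.

Lemma bounded_variable_indic A :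
  measurable A -> bounded_variable (\1_A : Omega -> R).
Proof.
move=> mA; apply/bounded_variableP; split; first exact: measurable_indic.
by exists 1 => w; rewrite indicE; case: (w \in A); rewrite ?normr1 ?normr0.
Qed.

Lemma measurable_superlevel X (c : R) :
  bounded_variable X -> measurable [set w | c <= X w].
Proof.
move=> [mX _]; have := mX measurableT `[c, +oo[%classic (measurable_itv _).
rewrite setTI; congr measurable; apply/seteqP.
by split=> w /=; rewrite in_itv /= andbT.
Qed.

Lemma indic_superlevel X (c : R) w :
  \1_[set w | c <= X w] w = (c <= X w)%R%:R :> R.
Proof.
by rewrite indicE; congr (nat_of_bool _)%:R; apply/idP/idP; rewrite in_setE.
Qed.

End BoundedVariables.

(** * Expectation functionals *)

Lemma le0_of_natmul_le (R : realType) (x C : R) :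
  (forall m : nat, m%:R * x <= C) -> x <= 0.
Proof.
move=> mx_le; rewrite leNgt; apply/negP => x_gt0.
have := truncnS_gt (C / x); rewrite ltr_pdivrMr // => C_lt.
by have := lt_le_trans C_lt (mx_le _); rewrite ltxx.
Qed.

Section ExpectationFunctionals.
Context {R : realType} {d : measure_display} {Omega : measurableType d}.
Implicit Types (X Y W : Omega -> R) (A : set Omega).
Variable E : (Omega -> R) -> R.
Hypothesis HE : expectation_functional E.

Lemma expectation_cst (c : R) : E (fun=> c) = c.
Proof.
apply/le_anti; rewrite andbC; apply: HE.1; first exact: bounded_variable_cst.
by move=> w; rewrite lexx.
Qed.

Lemma expectation_norm_le X (M : R) : bounded_variable X ->
  (forall w, `|X w| <= M) -> `|E X| <= M.
Proof. by move=> bX XM; rewrite ler_norml HE.1 // => w; rewrite -ler_norml. Qed.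

Lemma expectation_le X Y : bounded_variable X -> bounded_variable Y ->
  (forall w, X w <= Y w) -> E X <= E Y.
Proof.
move=> bX bY XY; have bYX := bounded_variableB bY bX.
have -> : Y = X \+ (fun w => Y w - X w).
  by apply/funext => w /=; rewrite addrC subrK.
rewrite HE.2 // lerDl.
have := (bounded_variableP _).1 bYX => -[_ [N YXN]].
have YX0N w : 0 <= Y w - X w <= N.
  by rewrite subr_ge0 XY (le_trans (ler_norm _)).
by have /andP[] := HE.1 _ _ _ bYX YX0N.
Qed.

(** Additivity makes the defect D t = E[t X] - t E[X] additive in t, and D
    vanishes at 1, hence at integers.  The value of D at m t therefore depends
    only on the fractional part of m t, so m |D t| stays bounded as m grows. *)
Lemma expectationZ (c : R) X : bounded_variable X ->
  E (fun w => c * X w) = c * E X.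
Proof.
move=> bX; pose D t := E (fun w => t * X w) - t * E X.
have bZ t : bounded_variable (fun w => t * X w).
  exact: bounded_variableM (bounded_variable_cst t) bX.
have DD t u : D (t + u) = D t + D u.
  rewrite /D; have -> : (fun w => (t + u) * X w) =
      (fun w => t * X w) \+ (fun w => u * X w).
    by apply/funext => w /=; rewrite mulrDl.
  by rewrite HE.2 //; ring.
have D1 : D 1 = 0.
  by rewrite /D mul1r; under eq_fun do rewrite mul1r; rewrite subrr.
have D0 : D 0 = 0 by have := DD 0 0; rewrite addr0; lra.
have DMn m t : D (m%:R * t) = m%:R * D t.
  elim: m => [|m IHm]; first by rewrite !mul0r.
  by rewrite -natr1 !mulrDl !mul1r DD IHm.
have [_ [M XM]] := (bounded_variableP _).1 bX.
have D_le t : 0 <= t <= 1 -> `|D t| <= M + M.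
  move=> /andP[t_ge0 t_le1]; rewrite (le_trans (ler_normB _ _)) // lerD //.
    apply: expectation_norm_le => // w; rewrite normrM ger0_norm //.
    by rewrite (le_trans _ (XM w)) // ler_piMl.
  rewrite normrM ger0_norm // (le_trans _ (expectation_norm_le bX XM)) //.
  by rewrite ler_piMl.
have D_ge0 t : 0 <= t -> D t = 0.
  move=> t_ge0; apply/eqP; rewrite -normr_le0.
  apply: (@le0_of_natmul_le _ _ (M + M)) => m.
  have mt_ge0 : 0 <= m%:R * t by rewrite mulr_ge0.
  have -> : m%:R * `|D t| = `|D (m%:R * t)|.
    by rewrite DMn normrM ger0_norm.
  have /andP[kl ku] := truncn_itv mt_ge0; set k := Num.truncn _ in kl ku.
  have Dk : D k%:R = 0 by have := DMn k 1; rewrite mulr1 D1 mulr0.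
  have := DD (m%:R * t - k%:R) k%:R; rewrite subrK Dk addr0 => ->.
  by apply: D_le; rewrite subr_ge0 kl /= lerBlDl natr1 ltW.
suff : D c = 0 by move/eqP; rewrite subr_eq0 => /eqP.
have [/D_ge0 //|c_lt0] := leP 0 c.
by have := DD c (- c); rewrite subrr D0 (D_ge0 (- c)) ?addr0 // oppr_ge0 ltW.
Qed.

Lemma expectationB X Y : bounded_variable X -> bounded_variable Y ->
  E (fun w => X w - Y w) = E X - E Y.
Proof.
move=> bX bY; have := HE.2 _ _ (bounded_variableB bX bY) bY.
have -> : (fun w => X w - Y w) \+ Y = X.
  by apply/funext => w /=; rewrite subrK.
by move=> ->; rewrite addrK.
Qed.

Lemma expectation_sumZ (N : nat) (c : R) (F : nat -> Omega -> R) :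
  (forall j, bounded_variable (F j)) ->
  E (fun w => \sum_(j < N) c * F j w) = \sum_(j < N) c * E (F j).
Proof.
move=> bF; elim: N => [|N IHN].
  by under eq_fun do rewrite big_ord0; rewrite big_ord0 expectation_cst.
under eq_fun do rewrite big_ord_recr /=; rewrite big_ord_recr /= -IHN.
rewrite -expectationZ // -HE.2 //.
  apply: bounded_variable_sum => j.
  exact: bounded_variableM (bounded_variable_cst c) (bF j).
exact: bounded_variableM (bounded_variable_cst c) (bF N).
Qed.

End ExpectationFunctionals.

(** * Supermartingale differences *)

(** The jumps sit at delta, 2 delta, ..., N delta, so that the staircase is a
    sum of indicators of superlevel sets of x. *)
Lemma staircase_approx (R : realType) (delta x : R) (N : nat) :
  0 < delta -> 0 <= x <= N%:R * delta ->
  0 <= x - \sum_(j < N) delta * (j.+1%:R * delta <= x)%R%:R <= delta.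
Proof.
move=> delta_gt0; elim: N => [|N IHN] /andP[x_ge0 x_le].
  by rewrite big_ord0 subr0; lra.
rewrite big_ord_recr /=; have [xN|Nx] := leP x (N%:R * delta).
  have /negbTE-> : ~~ (N.+1%:R * delta <= x).
    by rewrite -ltNge -natr1 mulrDl mul1r; lra.
  by rewrite mulr0 addr0 IHN // x_ge0.
rewrite (eq_bigr (fun=> delta)) => [|j _]; last first.
  rewrite (le_trans _ (ltW Nx)) ?mulr1 // ler_pM2r // ler_nat.
  exact: ltn_ord.
rewrite sumr_const card_ord -[delta *+ N]mulr_natl.
rewrite -natr1 mulrDl mul1r in x_le *.
have [?|?] := leP (N%:R * delta + delta) x.
  by rewrite mulr1; lra.
by rewrite mulr0 addr0; lra.
Qed.

Section SupermartingaleDifferences.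
Context {R : realType} {d : measure_display} {Omega : measurableType d}.
Implicit Types (Y W : Omega -> R) (A : set Omega).
Variable E : (Omega -> R) -> R.
Hypothesis HE : expectation_functional E.

(** A layer-cake argument: W is within delta of a staircase combination of
    indicators of its superlevel events, on each of which Y has nonpositive
    expectation.  The error, at most delta times the bound of Y, goes to 0 with
    the step delta. *)
Lemma expectation_weighted_le0 W Y :
    bounded_variable W -> bounded_variable Y -> (forall w, 0 <= W w) ->
    (forall c, E (Y \* \1_[set w | c <= W w]) <= 0) ->
  E (fun w => W w * Y w) <= 0.
Proof.
move=> bW bY W_ge0 Y_le0.
have [_ [M WM]] := (bounded_variableP _).1 bW.
have [_ [C YC]] := (bounded_variableP _).1 bY.
apply: (@le0_of_natmul_le _ _ ((`|M| + 1) * `|C|)) => -[|N].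
  by rewrite mul0r mulr_ge0 // addr_ge0.
set M1 := `|M| + 1; pose delta := M1 / N.+1%:R.
have M1_gt0 : 0 < M1 by rewrite ltr_wpDl.
have delta_gt0 : 0 < delta by rewrite divr_gt0.
have NdeltaE : N.+1%:R * delta = M1 by rewrite mulrC divfK // pnatr_eq0.
pose L j := [set w | j.+1%:R * delta <= W w].
have bL j : bounded_variable (Y \* \1_(L j)).
  apply: bounded_variableM => //; apply: bounded_variable_indic.
  exact: measurable_superlevel.
have bsum : bounded_variable
    (fun w => \sum_(j < N.+1) delta * (Y \* \1_(L j)) w).
  apply: bounded_variable_sum => j.
  exact: bounded_variableM (bounded_variable_cst delta) (bL j).
rewrite -NdeltaE -mulrA ler_pM2l ?ltr0n //.
apply: (@le_trans _ _ (E ((fun w => \sum_(j < N.+1) delta * (Y \* \1_(L j)) w)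
    \+ (fun=> delta * `|C|)))).
  apply: expectation_le => //.
  - exact: bounded_variableM.
  - by apply: bounded_variableD => //; exact: bounded_variable_cst.
  - move=> w /=.
    have -> : \sum_(j < N.+1) delta * (Y w * \1_(L j) w) =
        (\sum_(j < N.+1) delta * (j.+1%:R * delta <= W w)%R%:R) * Y w.
      rewrite mulr_suml; apply: eq_bigr => j _.
      by rewrite indic_superlevel mulrCA mulrC.
    rewrite -lerBlDl -mulrBl.
    have /(staircase_approx delta_gt0)/andP[] : 0 <= W w <= N.+1%:R * delta.
      rewrite W_ge0 NdeltaE (le_trans (ler_norm _)) // (le_trans (WM w)) //.
      by rewrite (le_trans (ler_norm _)) // lerDl.
    move=> e_ge0 e_le; apply: (le_trans (ler_norm _)).
    rewrite normrM ger0_norm //.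
    by apply: ler_pM => //; rewrite (le_trans (YC w)) ?ler_norm.
rewrite HE.2 //; last exact: bounded_variable_cst.
rewrite expectation_cst // (expectation_sumZ HE _ _ bL).
rewrite gerDr; apply: sumr_le0 => j _.
by rewrite mulr_ge0_le0 ?Y_le0 // ltW.
Qed.

(** These are the events A(Y_1, ..., Y_(i-1)).  Stated on pairs of points instead
    of through a set of tuples, the notion is visibly unchanged when a constant
    is added to the Y j or their sign is reversed. *)
Definition past_event n (Y : 'I_n -> Omega -> R) (i : 'I_n) A : Prop :=
  forall w w', (forall j : 'I_n, (j < i)%N -> Y j w = Y j w') -> A w -> A w'.

Section AzumaHoeffding.
Variables (n : nat) (Y : 'I_n -> Omega -> R) (a b B : 'I_n -> R).
Hypothesis bY : forall i, bounded_variable (Y i).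
Hypothesis ab0 : forall i, a i <= 0 <= b i.
Hypothesis abY : forall i w, a i <= Y i w <= b i.
Hypothesis abB : forall i, b i - a i <= B i.
Hypothesis Y_le0 : forall i A, measurable A -> past_event Y i A ->
  E (Y i \* \1_A) <= 0.

(** By induction on m: the factor exp(s Y_m) is replaced by its affine majorant,
    whose linear part has nonpositive expectation against the exponential of
    the earlier sum, a nonnegative variable whose superlevel events are past
    events. *)
Lemma mgf_partial_sum_le (s : R) (m : nat) : 0 <= s -> (m <= n)%N ->
  E (fun w => expR (s * \sum_(i < n | (i < m)%N) Y i w)) <=
  expR (s ^+ 2 * (\sum_(i < n | (i < m)%N) B i ^+ 2) / 8).
Proof.
move=> s_ge0; elim: m => [_|m IHm m_lt_n].
  rewrite big_pred0_eq mulr0 mul0r expR0.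
  under eq_fun do rewrite big_pred0_eq mulr0 expR0.
  by rewrite expectation_cst.
pose i := Ordinal m_lt_n.
have splitS (V : nmodType) (F : 'I_n -> V) : \sum_(j < n | (j < m.+1)%N) F j =
    F i + \sum_(j < n | (j < m)%N) F j.
  rewrite (bigD1 i) //=; congr (_ + _); apply: eq_bigl => j.
  by rewrite ltnS ltn_neqAle andbC.
pose W w := expR (s * \sum_(j < n | (j < m)%N) Y j w).
have bW : bounded_variable W.
  apply/bounded_variable_expR/bounded_variableM.
    exact: bounded_variable_cst.
  exact: bounded_variable_sum.
have /andP[a_le0 b_ge0] := ab0 i.
have [beta beta_ge0 exp_le] := exp_le_affine a_le0 b_ge0 s_ge0.
set c := expR (s ^+ 2 * (b i - a i) ^+ 2 / 8) in exp_le.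
have c_le : c <= expR (s ^+ 2 * B i ^+ 2 / 8).
  rewrite ler_expR ler_wpM2r // ler_wpM2l ?sqr_ge0 //.
  have baB := abB i; rewrite ler_sqr ?nnegrE //; lra.
have bcst := @bounded_variable_cst R d Omega.
have bWY := bounded_variableM bW (bY i).
have bl : bounded_variable (fun w => c * W w) by exact: bounded_variableM.
have br : bounded_variable (fun w => beta * (W w * Y i w)).
  exact: bounded_variableM.
apply: (@le_trans _ _
    (E ((fun w => c * W w) \+ (fun w => beta * (W w * Y i w))))).
  apply: expectation_le => //.
  - apply/bounded_variable_expR/bounded_variableM => //.
    exact: bounded_variable_sum.
  - exact: bounded_variableD.
  - move=> w /=; rewrite splitS mulrDr expRD -/(W w).
    have -> : c * W w + beta * (W w * Y i w) = (c + beta * Y i w) * W w by ring.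
    by rewrite ler_pM2r ?expR_gt0 // exp_le.
have WY_le0 : E (fun w => W w * Y i w) <= 0.
  apply: expectation_weighted_le0 => // [w|t]; first exact: expR_ge0.
  apply: Y_le0; first exact: measurable_superlevel.
  move=> w w' YY /=; congr (_ <= expR (_ * _)).
  by apply: eq_bigr => j /YY.
rewrite HE.2 // !expectationZ //.
rewrite splitS mulrDr mulrDl expRD -[leRHS]addr0 lerD //.
  rewrite ler_pM ?expR_ge0 // ?IHm 1?ltnW //.
  by rewrite -(expectation_cst HE 0) expectation_le // => w; exact: expR_ge0.
by rewrite mulr_ge0_le0.
Qed.

Lemma azuma_hoeffding (eps : R) :
    0 < \sum_(i < n) B i ^+ 2 -> 0 < eps ->
  E \1_[set w | \sum_(i < n) Y i w >= eps]
    <= expR (- (2 * eps ^+ 2 / \sum_(i < n) B i ^+ 2)).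
Proof.
set gamma := \sum_(i < n) _ => gamma_gt0 eps_gt0.
(* This s minimizes the exponent s^2 gamma / 8 - s eps. *)
pose s := 4 * eps / gamma.
have s_ge0 : 0 <= s by rewrite divr_ge0 ?mulr_ge0 // ltW.
have bS : bounded_variable (fun w => \sum_(i < n) Y i w).
  exact: bounded_variable_sum.
have bexp : bounded_variable (fun w => expR (s * \sum_(i < n) Y i w)).
  apply/bounded_variable_expR/bounded_variableM => //.
  exact: bounded_variable_cst.
have mgf := mgf_partial_sum_le s_ge0 (leqnn n).
have fullS (V : nmodType) (F : 'I_n -> V) :
    \sum_(i < n | (i < n)%N) F i = \sum_(i < n) F i.
  by apply: eq_bigl => i; rewrite ltn_ord.
rewrite fullS -/gamma in mgf.
rewrite (_ : (fun w => _) = fun w => expR (s * \sum_(i < n) Y i w)) in mgf;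
  last by apply/funext => w; rewrite fullS.
apply: (@le_trans _ _ (expR (- (s * eps)) *
    E (fun w => expR (s * \sum_(i < n) Y i w)))).
  rewrite -expectationZ //; apply: expectation_le => //.
  - exact/bounded_variable_indic/measurable_superlevel.
  - exact: bounded_variableM (bounded_variable_cst _) bexp.
  - move=> w; rewrite indic_superlevel -expRD.
    have [S_ge|_] := leP eps (\sum_(i < n) Y i w); last exact: expR_ge0.
    by rewrite -expR0 ler_expR addrC subr_ge0 ler_wpM2l.
apply: (@le_trans _ _ (expR (- (s * eps)) * expR (s ^+ 2 * gamma / 8))).
  by rewrite ler_pM2l ?expR_gt0.
rewrite -expRD ler_expR /s le_eqVlt; apply/orP; left; apply/eqP.
by field; rewrite gt_eqF.
Qed.

End AzumaHoeffding.
End SupermartingaleDifferences.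

(** * Weak irrelevance *)

Section WeakIrrelevance.
Context {R : realType} {d : measure_display} {Omega : measurableType d}.
Variables (s : setup) (K : set ((Omega -> R) -> R)).
Variable cond : ((Omega -> R) -> R) -> set Omega -> (Omega -> R) -> R.
Hypothesis K_expectation : forall E, K E -> expectation_functional E.
Hypothesis K_cond : conditioning s K cond.

Lemma lower_upper_bounds E X : K E -> bounded_variable X ->
  lower K X <= E X <= upper K X.
Proof.
move=> KE bX; have [_ [M XM]] := (bounded_variableP _).1 bX.
have EM F : K F -> `|F X| <= M.
  by move=> /K_expectation HF; exact: expectation_norm_le.
apply/andP; split.
  apply: ge_inf; last by exists E.
  by exists (- M) => _ [F /EM + <-]; rewrite ler_norml => /andP[].
apply: ub_le_sup; last by exists E.
by exists M => _ [F /EM + <-]; rewrite ler_norml => /andP[].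
Qed.

Lemma lower_upper_given_bounds E A X : K E -> measurable A ->
    defined_for s E A -> bounded_variable X ->
  lower_given s K cond A X <= cond E A X <= upper_given s K cond A X.
Proof.
move=> KE mA EA bX; have [_ [M XM]] := (bounded_variableP _).1 bX.
have EM F : K F /\ defined_for s F A -> `|cond F A X| <= M.
  move=> [KF FA]; have [HF _] := (K_cond KF).1 A mA FA.
  exact: expectation_norm_le.
apply/andP; split.
  apply: ge_inf; last by exists E.
  by exists (- M) => _ [F /EM + <-]; rewrite ler_norml => /andP[].
apply: ub_le_sup; last by exists E.
by exists M => _ [F /EM + <-]; rewrite ler_norml => /andP[].
Qed.

(** On a past event of positive probability this is the defining equation of
    E[X_i | A] combined with weak irrelevance; on a null event, where E[X_i | A]
    may be undefined or unconstrained by E, all three terms vanish. *)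
Lemma irrelevance_bounds n (X : 'I_n -> Omega -> R) E i A :
    (forall j, bounded_variable (X j)) -> weak_irrelevance s K cond X ->
    K E -> measurable A -> past_event X i A ->
  lower K (X i) * E \1_A <= E (X i \* \1_A) <= upper K (X i) * E \1_A.
Proof.
move=> bX irr KE mA pastA; have HE := K_expectation KE.
have bA := @bounded_variable_indic R _ _ _ mA.
have [_ [M XM]] := (bounded_variableP _).1 (bX i).
have indic_ge0 w : 0 <= \1_A w :> R by rewrite indicE.
have EA_ge0 : 0 <= E \1_A.
  rewrite -(expectation_cst HE 0) expectation_le //.
  exact: bounded_variable_cst.
have bXA := bounded_variableM (bX i) bA.
have [PA0|PA_neq0] := eqVneq (E \1_A) 0.
  have bc (c : R) : bounded_variable (fun w => c * \1_A w).
    exact: bounded_variableM (bounded_variable_cst c) bA.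
  have XA_le : E (X i \* \1_A) <= M * E \1_A.
    rewrite -expectationZ // expectation_le // => w /=.
    by rewrite ler_wpM2r // (le_trans (ler_norm _)).
  have XA_ge : - M * E \1_A <= E (X i \* \1_A).
    rewrite -expectationZ // expectation_le // => w /=.
    by rewrite ler_wpM2r //; move: (XM w); rewrite ler_norml => /andP[].
  by move: XA_le XA_ge; rewrite PA0 !mulr0 => -> ->.
have PA_gt0 : 0 < E \1_A by rewrite lt_neqAle eq_sym PA_neq0.
have [w0 Aw0] : A !=set0.
  apply: contrapT => /set0P/negP/negPn/eqP A0; move: PA_neq0.
  by rewrite A0 indic0 expectation_cst ?eqxx.
(* Without predecessors, the only nonempty past event is the sure event. *)
have [i0|i_gt0] := posnP i.
  have AT : A = setT.
    apply/seteqP; split=> // w _; apply: pastA Aw0 => j.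
    by rewrite i0.
  rewrite AT indicT expectation_cst // !mulr1.
  have -> : X i \* cst 1 = X i by apply/funext => w /=; rewrite mulr1.
  exact: lower_upper_bounds.
pose Z := joint (prefix X (ltnW (ltn_ord i))).
have AE : Z @^-1` (Z @` A) = A.
  apply/seteqP; split=> w; last by exists w.
  move=> [w' Aw' ZZ]; apply: pastA Aw' => j j_lt_i.
  have := congr1 (fun t => tnth t (Ordinal j_lt_i)) ZZ.
  rewrite !tnth_mktuple /prefix.
  suff -> : widen_ord (ltnW (ltn_ord i)) (Ordinal j_lt_i) = j by [].
  exact: val_inj.
have EA : defined_for s E A by case: (s) => //=; exists w0.
have KA : defined_given s K A.
  case: (s) => /=; first by exists w0.
  by apply: lt_le_trans PA_gt0 _; have /andP[] := lower_upper_bounds KE bA.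
have [_ /(_ _ (bX i)) condE] := (K_cond KE).1 A mA EA.
have := irr i (Z @` A) i_gt0; rewrite -/Z AE => /(_ mA KA)[<- <-].
rewrite -condE !ler_pM2r //.
exact: lower_upper_given_bounds.
Qed.

End WeakIrrelevance.

(** * The concentration inequality *)

Theorem theorem2 (R : realType) (d : measure_display) (Omega : measurableType d)
    (s : setup) (K : set ((Omega -> R) -> R))
    (cond : ((Omega -> R) -> R) -> set Omega -> (Omega -> R) -> R)
    (K_nonempty : K !=set0)
    (K_expectation : forall E, K E -> expectation_functional E)
    (K_cond : conditioning s K cond)
    (n : nat) (X : 'I_n -> Omega -> R) (B : 'I_n -> R)
    (X_variable : forall i, bounded_variable (X i))
    (X_range : forall i, sup (range (X i)) - inf (range (X i)) <= B i)
    (gamma_gt0 : 0 < \sum_(i < n) B i ^+ 2)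
    (X_irrelevant : weak_irrelevance s K cond X)
    (X_disintegrable : disintegrability s K cond X)
    (eps : R) (eps_gt0 : 0 < eps) :
  upper K \1_[set w | \sum_(i < n) (X i w - upper K (X i)) >= eps]
    <= expR (- (2 * eps ^+ 2 / \sum_(i < n) B i ^+ 2)) /\
  upper K \1_[set w | \sum_(i < n) (X i w - lower K (X i)) <= - eps]
    <= expR (- (2 * eps ^+ 2 / \sum_(i < n) B i ^+ 2)).
Proof.
pose mn i := inf (range (X i)); pose mx i := sup (range (X i)).
have X_itv i w : mn i <= X i w <= mx i.
  rewrite ge_inf ?ub_le_sup //; try by exists w.
    exact/bounded_fun_has_ubound/(X_variable i).2.
  exact/bounded_fun_has_lbound/(X_variable i).2.
have E_itv i E : K E -> mn i <= E (X i) <= mx i.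
  by move=> /K_expectation[HE _]; exact: HE.
have [E0 KE0] := K_nonempty.
have upper_itv i : mn i <= upper K (X i) <= mx i.
  have /andP[_ E0_le] := lower_upper_bounds K_expectation KE0 (X_variable i).
  have /andP[mnE0 _] := E_itv i _ KE0.
  rewrite (le_trans mnE0) //= ge_sup //; first by exists (E0 (X i)), E0.
  by move=> _ [E KE <-]; have /andP[] := E_itv i _ KE.
have lower_itv i : mn i <= lower K (X i) <= mx i.
  have /andP[E0_ge _] := lower_upper_bounds K_expectation KE0 (X_variable i).
  have /andP[_ E0mx] := E_itv i _ KE0.
  rewrite (le_trans _ E0mx) ?andbT // lb_le_inf //.
    by exists (E0 (X i)), E0.
  by move=> _ [E KE <-]; have /andP[] := E_itv i _ KE.
have bcst := @bounded_variable_cst R d Omega.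
have irr E i A (KE : K E) (mA : measurable A) (pA : past_event X i A) :=
  irrelevance_bounds K_expectation K_cond X_variable X_irrelevant KE mA pA.
split.
- apply: ge_sup; first by exists (E0 \1_[set w |
     eps <= \sum_(i < n) (X i w - upper K (X i))]), E0.
  move=> _ [E KE <-]; have HE := K_expectation _ KE.
  apply: (azuma_hoeffding HE (Y := fun i w => X i w - upper K (X i))
    (a := fun i => mn i - upper K (X i)) (b := fun i => mx i - upper K (X i)))
    => // [i|i|i w|i|i A mA pA].
  + exact: bounded_variableB.
  + by have /andP[? ?] := upper_itv i; rewrite subr_le0 subr_ge0; apply/andP.
  + by have /andP[? ?] := X_itv i w; rewrite !lerD2r; apply/andP.
  + by have := X_range i; rewrite -/(mn i) -/(mx i); lra.
  + have pXA : past_event X i A.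
      by move=> w w' XX; apply: pA => j /XX ->.
    have bA := @bounded_variable_indic R _ _ _ mA.
    have bXA := bounded_variableM (X_variable i) bA.
    have /andP[_] := irr _ _ _ KE mA pXA.
    have -> : (fun w => X i w - upper K (X i)) \* \1_A =
        (fun w => (X i \* \1_A) w - upper K (X i) * \1_A w).
      by apply/funext => w /=; rewrite mulrBl.
    rewrite expectationB // ?expectationZ ?subr_le0 //.
    exact: bounded_variableM.
- apply: ge_sup; first by exists (E0 \1_[set w |
     \sum_(i < n) (X i w - lower K (X i)) <= - eps]), E0.
  move=> _ [E KE <-]; have HE := K_expectation _ KE.
  have -> : [set w | \sum_(i < n) (X i w - lower K (X i)) <= - eps] =
      [set w | eps <= \sum_(i < n) (lower K (X i) - X i w)].
    apply/funext => w /=; rewrite lerNr -sumrN.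
    by congr (is_true (eps <= _)); apply: eq_bigr => i _; rewrite opprB.
  apply: (azuma_hoeffding HE (Y := fun i w => lower K (X i) - X i w)
    (a := fun i => lower K (X i) - mx i) (b := fun i => lower K (X i) - mn i))
    => // [i|i|i w|i|i A mA pA].
  + exact: bounded_variableB.
  + by have /andP[? ?] := lower_itv i; rewrite subr_le0 subr_ge0; apply/andP.
  + by have /andP[? ?] := X_itv i w; rewrite !lerD2l !lerN2; apply/andP.
  + by have := X_range i; rewrite -/(mn i) -/(mx i); lra.
  + have pXA : past_event X i A.
      by move=> w w' XX; apply: pA => j /XX ->.
    have bA := @bounded_variable_indic R _ _ _ mA.
    have bXA := bounded_variableM (X_variable i) bA.
    have /andP[+ _] := irr _ _ _ KE mA pXA.
    have -> : (fun w => lower K (X i) - X i w) \* \1_A =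
        (fun w => lower K (X i) * \1_A w - (X i \* \1_A) w).
      by apply/funext => w /=; rewrite mulrBl.
    rewrite expectationB // ?expectationZ ?subr_le0 //.
    exact: bounded_variableM.
Qed.
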